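(* Let $\beta_1, \beta_2 \in [0,1]$ be distinct, let $\delta_1,\delta_2 \in (0,1/3)$, and let $\pi_1,\pi_2>0$ with $\pi_1+\pi_2=1$. Let $\sigma$ be the invariant probability measure of the two-map affine IFS $\phi_i(s) = \delta_i(s-\beta_i)+\beta_i$, $i=1,2$, with weights $\pi_1,\pi_2$, and assume that this IFS is disconnected. Let $\delta \in (0,1)$ and let $\mu$ be the invariant measure of the affine $(\delta,\sigma)$-homogeneous IFS, with contraction ratio $\delta$ and distribution of fixed points $\sigma$. Then the support of $\mu$ contains an interval (of positive length).
   Context: The invariant measure $\sigma$ of a finite IFS $\{\phi_i\}_{i=1}^M$ with weights $\pi_i>0$, $\sum_i \pi_i=1$, is the unique Borel probability measure on $\mathbf{R}$ satisfying $\int f\,d\sigma = \sum_{i=1}^M \pi_i \int f(\phi_i(s))\,d\sigma(s)$ for all continuous $f$. The support of $\sigma$ is the attractor of the IFS, i.e. the unique non-empty compact set $K$ with $K=\bigcup_i \phi_i(K)$. The two-map IFS is disconnected if $\phi_1(K)\cap\phi_2(K)=\emptyset$. Affine $(\delta,\sigma)$-homogeneous IFS: for a Borel probability measure $\sigma$ with support contained in $[0,1]$ and $\delta\in[0,1)$, put $\bar\delta := 1-\delta$ and $\phi_\delta(\beta,s) := \delta s + \bar\delta \beta$. The IFS consists of the maps $\phi_\delta(\beta,\cdot)$ with $\beta$ distributed according to $\sigma$, and its invariant measure $\mu$ is the unique Borel probability measure satisfying $$\int f(s)\,d\mu(s) = \int d\sigma(\beta)\int d\mu(s)\, f(\phi_\delta(\beta,s))$$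 for every continuous function $f$. *)

(* Defs.v *)
From HB Require Import structures.
From mathcomp Require Import all_boot all_order all_algebra.
From mathcomp Require Import all_classical all_reals all_analysis.

Set Implicit Arguments.
Unset Strict Implicit.
Unset Printing Implicit Defensive.

Import Order.TTheory GRing.Theory Num.Theory.
Import numFieldNormedType.Exports.

Local Open Scope classical_set_scope.
Local Open Scope ring_scope.

Definition borel_probability (R : realType) := probability (measurableTypeR R) R.

Definition measure_support (R : realType) (mu : borel_probability R) : set R :=
  [set x | forall U : set R, open U -> U x -> (0 < mu U)%E].

Definition affine_map (R : realType) (delta beta s : R) : R :=
  delta * (s - beta) + beta.

Definition is_attractor (R : realType) (M : nat) (phi : 'I_M -> R -> R)
    (K : set R) : Prop :=
  [/\ K !=set0, compact K & K = \bigcup_(i in [set: 'I_M]) (phi i @` K)].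

(* The attractor of a contractive IFS exists and is unique, so "for some
   attractor K" and "for the attractor K" agree. *)
Definition disconnected_IFS (R : realType) (phi : 'I_2 -> R -> R) : Prop :=
  exists K : set R, is_attractor phi K /\
    phi ord0 @` K `&` phi ord_max @` K = set0.

(* The integrals are extended-real valued. The invariant measure of a
   contractive IFS has compact support, so for that measure they are finite for
   every continuous f, bounded or not; the same holds for the homogeneous IFS
   below when sigma is supported in [0,1] and 0 <= delta < 1. *)
Definition is_invariant_measure (R : realType) (M : nat) (phi : 'I_M -> R -> R)
    (w : 'I_M -> R) (sigma : borel_probability R) : Prop :=
  forall f : R -> R, continuous f ->
    (\int[sigma]_s (f s)%:E
     = \sum_(i < M) (w i)%:E * \int[sigma]_s (f (phi i s))%:E)%E.

Definition homogeneous_map (R : realType) (delta beta s : R) : R :=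
  delta * s + (1 - delta) * beta.

Definition is_homogeneous_invariant_measure (R : realType) (delta : R)
    (sigma mu : borel_probability R) : Prop :=
  forall f : R -> R, continuous f ->
    (\int[mu]_s (f s)%:E
     = \int[sigma]_beta \int[mu]_s (f (homogeneous_map delta beta s))%:E)%E.

(* Main.v *)
Require Import Defs.
From mathcomp Require Import all_boot all_order all_algebra.
From mathcomp Require Import all_classical all_reals all_analysis.
From mathcomp Require Import measurable_realfun ring lra.

Set Implicit Arguments.
Unset Strict Implicit.
Unset Printing Implicit Defensive.

Import Order.TTheory GRing.Theory Num.Theory.
Import numFieldNormedType.Exports.

Local Open Scope classical_set_scope.
Local Open Scope ring_scope.

(** Write [C] for the support of [sigma] and [K] for the support of [mu].
    Both are closed and nonempty; [C] is mapped into itself by the two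
    contractions, and [K] is mapped into itself by [s |-> delta s + (1-delta) c]
    for every [c] in [C].  Iterating, [K] contains every sum
    [(1 - delta) * (c_0 + delta c_1 + delta^2 c_2 + ...)] with [c_n] in [C]
    ([affine_orbit_mem] and closedness), so it suffices to find an interval of
    such sums.

    The two contractions may have different ratios, but their two compositions
    [phi_1 phi_2] and [phi_2 phi_1] share the ratio [r = delta_1 delta_2] and
    have different translation parts.  Hence, for every [M], the set [C]
    contains all points [u + d * (sum over k < M of e_k r^k)] with digits [e_k]
    in {0,1} and some [d <> 0].  Therefore [K] contains an affine image of all
    the sums of [e_(n,k) delta^n r^k] over [n >= 0] and [k < M], with digits
    [e_(n,k)] that can be chosen freely.  The point is that this family of
    weights is much denser than a geometric progression: for each [k] there is
    a delay [p_k] such that [a_k = delta^(p_k) r^k] lies within a factor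
    [delta] of [r^M] ([geometric_rescaling]), so that there are [M] weights of
    comparable size at each of the scales [delta^m r^M].  As soon as
    [M delta^2 >= 1], a greedy algorithm ([prefix_digit_expansion]) writes every
    number of an interval [[0, H]] as the sum over [m] of [delta^m] times a
    subset sum of the [a_k].  Delaying the [k]-th digit sequence by [p_k]
    ([cvg_sum_delay]) turns this expansion into one of the required form. *)

(** * Supports of Borel probability measures *)

Section Support.
Context {R : realType}.
Implicit Types (nu : borel_probability R) (y : R).

Lemma closed_measure_support nu : closed (measure_support nu).
Proof.
move=> x clx U oU Ux; have [z [zS Uz]] := clx _ (open_nbhs_nbhs (conj oU Ux)).
exact: zS oU Uz.
Qed.

(** The line has a countable base: if every point had a null neighbourhood, the
    line would be the union of the null intervals with rational endpoints. *)
Lemma measure_support_neq0 nu : measure_support nu !=set0.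
Proof.
apply/set0P/eqP => S0.
pose I (p : rat * rat) : set R := [set` `]ratr p.1, ratr p.2[].
(* the null rational intervals, enumerated through the codes of rat * rat *)
pose F n : set R := if unpickle n is Some p then
  if nu (I p) == 0%E then I p else set0 else set0.
have mI p : measurable (I p : set (measurableTypeR R)).
  exact: measurable_itv.
have : nu.-negligible (\bigcup_n F n).
  apply: negligible_bigcup => n; rewrite /F.
  case: (unpickle n) => [p|]; last exact: negligible_set0.
  case: eqP => [p0|_]; last exact: negligible_set0.
  exact/(negligibleP nu (mI p)).
have -> : \bigcup_n F n = setT.
  rewrite -subTset => x _.
  have /existsNP[U /not_implyP[oU /not_implyP[Ux nU]]] : ~ measure_support nu x.
    by rewrite S0.
  have [e /= e0 eU] : exists2 e : R, 0 < e & ball x e `<=` U.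
    by have /nbhs_ballP[e /= e0 eU] := open_nbhs_nbhs (conj oU Ux); exists e.
  have [p /itvP px] : exists p : rat, ratr p \in `]x - e, x[.
    by apply: rat_in_itvoo; lra.
  have [q /itvP qx] : exists q : rat, ratr q \in `]x, x + e[.
    by apply: rat_in_itvoo; lra.
  exists (pickle (p, q)); first exact: Logic.I.
  rewrite /F pickleK.
  have IU : I (p, q) `<=` U.
    move=> z; rewrite /I/= in_itv/= => /andP[z1 z2]; apply: eU.
    rewrite /ball/= ltr_norml; have := px; have := qx.
    move=> /= qx' px'; have h1 : x - e < ratr p by rewrite px'.
    have h2 : ratr q < x + e by rewrite qx'.
    by apply/andP; split; lra.
  case: eqP => [_|[]]; first by rewrite /I/= in_itv/= px qx.
  apply/eqP; rewrite -measure_le0 leNgt; apply/negP => I0; apply: nU.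
  apply: lt_le_trans I0 _; apply: le_measure => //; rewrite ?inE//.
  exact: open_measurable.
move=> /(negligibleP nu measurableT) nu0.
have : (1 = 0 :> \bar R)%E := etrans (esym (probability_setT nu)) nu0.
by case=> /eqP; rewrite oner_eq0.
Qed.

Lemma integral_ge_cst nu (V : set R) (c : \bar R) (f : R -> \bar R) :
  open V -> measurable_fun [set: measurableTypeR R] f ->
  (0 <= c)%E -> (forall x, 0 <= f x)%E ->
  (forall x, V x -> c <= f x)%E -> (c * nu V <= \int[nu]_x f x)%E.
Proof.
move=> oV mf c0 f0 cf.
have mV : measurable (V : set (measurableTypeR R)) by exact: open_measurable.
rewrite -integral_cst//.
apply: (@le_trans _ _ (\int[nu]_(x in V) f x)%E).
  by apply: ge0_le_integral => //; exact: measurable_funTS.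
exact: ge0_subset_integral.
Qed.

Definition tent (y e z : R) := Num.max 0 (e - `|z - y|).

Lemma tent_ge0 y e z : 0 <= tent y e z.
Proof. by rewrite le_max lexx. Qed.

Lemma continuous_tent y e : continuous (tent y e).
Proof.
move=> z; apply: (@continuous_max _ _ (fun=> 0) (fun z => e - `|z - y|)).
  exact: cvg_cst.
apply: cvgB; first exact: cvg_cst.
apply: cvg_norm; apply: cvgB; first exact: cvg_id.
exact: cvg_cst.
Qed.

Lemma measurable_tent y e : measurable_fun [set: measurableTypeR R] (tent y e).
Proof. apply: continuous_measurable_fun; exact: continuous_tent. Qed.

Lemma measurable_EFin_tent y e :
  measurable_fun [set: measurableTypeR R] (fun z => (tent y e z)%:E).
Proof. by apply/measurable_EFinP; exact: measurable_tent. Qed.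

Lemma tent_ge y e z : `|z - y| < e / 2 -> e / 2 <= tent y e z.
Proof. by move=> zy; rewrite le_max; apply/orP; right; lra. Qed.

(** Invariance of a measure is tested on continuous functions, whereas the
    support speaks of open sets; tents centred at the point translate one into
    the other, since a narrow tent vanishes outside a given neighbourhood. *)
Lemma measure_support_tent nu y :
  (forall e, 0 < e -> (0 < \int[nu]_z (tent y e z)%:E)%E) -> measure_support nu y.
Proof.
move=> H U oU Uy.
have /nbhs_ballP[e /= e0 eU] := open_nbhs_nbhs (conj oU Uy).
have mU : measurable (U : set (measurableTypeR R)) by exact: open_measurable.
rewrite lt_neqAle measure_ge0 andbT eq_sym; apply/negP => /eqP U0.
suff tent0 : (\int[nu]_z (tent y e z)%:E = 0)%E.
  by move: (H e e0); rewrite tent0 ltxx.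
transitivity (\int[nu]_(z in U) (tent y e z)%:E)%E; last first.
  apply: null_set_integral => //.
  by apply: measurable_funTS; exact: measurable_EFin_tent.
rewrite [RHS]integral_mkcond; apply: eq_integral => z _.
rewrite /patch; case: ifPn => // /negP; rewrite inE => nUz; congr EFin.
apply/eqP; rewrite /tent eq_maxl subr_le0 leNgt; apply/negP => ze.
by apply: nUz; apply: eU; rewrite /ball/= distrC.
Qed.

End Support.

(** By invariance, the integral of a tent centred at the image of [s] is at
    least [w i] times the integral of its pullback, which is bounded below near
    [s] because the map does not increase distances. *)
Lemma support_invariant (R : realType) (M : nat) (b d w : 'I_M -> R)
    (nu : borel_probability R) (i : 'I_M) (s : R) :
  (forall i, 0 < w i) -> 0 <= d i <= 1 ->
  is_invariant_measure (fun i => affine_map (d i) (b i)) w nu ->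
  measure_support nu s -> measure_support nu (affine_map (d i) (b i) s).
Proof.
move=> w0 /andP[d0 d1] inv ss; set y := affine_map _ _ _.
apply: measure_support_tent => e e0; rewrite inv; last exact: continuous_tent.
rewrite (bigD1 i)//=; apply: lt_le_trans; last first.
  apply: leeDl; apply: sume_ge0 => j _; apply: mule_ge0.
    by rewrite lee_fin ltW.
  by apply: integral_ge0 => z _; rewrite lee_fin tent_ge0.
apply: mule_gt0; first by rewrite lte_fin.
apply: (@lt_le_trans _ _ ((e / 2)%:E * nu (ball s (e / 2)))%E).
  apply: mule_gt0; first by rewrite lte_fin divr_gt0.
  by apply: ss; [exact: ball_open|apply: ballxx; rewrite divr_gt0].
apply: integral_ge_cst.
- exact: ball_open.
- apply/measurableT_comp => //; apply: measurableT_comp.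
    exact: measurable_tent.
  apply: continuous_measurable_fun => z.
  apply: cvgD; last exact: cvg_cst.
  apply: cvgM; first exact: cvg_cst.
  by apply: cvgB; [exact: cvg_id|exact: cvg_cst].
- by rewrite lee_fin divr_ge0// ltW.
- by move=> z; rewrite lee_fin tent_ge0.
move=> z; rewrite /ball/= => sz; rewrite lee_fin; apply: tent_ge.
rewrite (_ : _ - y = d i * (z - s)); last by rewrite /y /affine_map; ring.
rewrite normrM (ger0_norm d0); apply: le_lt_trans sz.
by rewrite distrC ler_piMl.
Qed.

(** As for finitely many maps, with a double integral: the map is a convex
    combination of [beta] and [s], so the tent of width [e] is at least [e / 2]
    on the product of the balls of radius [e / 2]. *)
Lemma support_homogeneous (R : realType) (delta : R)
    (sigma mu : borel_probability R) (beta s : R) :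
  0 <= delta <= 1 -> is_homogeneous_invariant_measure delta sigma mu ->
  measure_support sigma beta -> measure_support mu s ->
  measure_support mu (homogeneous_map delta beta s).
Proof.
move=> /andP[d0 d1] inv sb ss; set y := homogeneous_map _ _ _.
apply: measure_support_tent => e e0; rewrite inv; last exact: continuous_tent.
pose f (p : measurableTypeR R * measurableTypeR R) : \bar R :=
  (tent y e (homogeneous_map delta p.1 p.2))%:E.
have mf : measurable_fun setT f.
  apply/measurableT_comp => //; apply: measurableT_comp.
    exact: measurable_tent.
  by apply: measurable_funD; apply: measurable_funM.
have f0 p : (0 <= f p)%E by rewrite lee_fin tent_ge0.
have e2 : 0 < e / 2 by rewrite divr_gt0.
(* lower bound for the inner integral, uniform over the ball around beta *)
pose c := ((e / 2)%:E * mu (ball s (e / 2)))%E.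
have c0 : (0 < c)%E.
  apply: mule_gt0; first by rewrite lte_fin.
  by apply: ss; [exact: ball_open|exact: ballxx].
apply: (@lt_le_trans _ _ (c * sigma (ball beta (e / 2)))%E).
  apply: mule_gt0 => //.
  by apply: sb; [exact: ball_open|exact: ballxx].
apply: integral_ge_cst.
- exact: ball_open.
- exact: (measurable_fun_fubini_tonelli_F (m2 := mu) f).
- exact: ltW.
- by move=> b; apply: integral_ge0 => z _; exact: (f0 (b, z)).
move=> b; rewrite /ball/= => bb.
apply: integral_ge_cst.
- exact: ball_open.
- exact: (measurableT_comp mf (pair1_measurable b)).
- by rewrite lee_fin ltW.
- by move=> z; exact: (f0 (b, z)).
move=> z; rewrite /ball/= => sz; rewrite lee_fin; apply: tent_ge.
rewrite (_ : _ - y = delta * (z - s) + (1 - delta) * (b - beta)); last first.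
  by rewrite /y /homogeneous_map; ring.
apply: le_lt_trans (ler_normD _ _) _; rewrite !normrM.
rewrite (ger0_norm d0) (@ger0_norm _ (1 - delta)) ?subr_ge0// distrC (distrC b).
by have [AB|/ltW BA] := leP `|s - z| `|beta - b|; nra.
Qed.

(** * Digit expansions *)

(** Used both for the finite words in the two compositions and for the partial
    sums that approximate the points of the support of [mu]. *)
Lemma affine_orbit_mem (R : realType) (K T : set R) (rho s : R) (t : nat -> R) N :
  (forall x y, K x -> T y -> K (rho * x + y)) ->
  (forall n, T (t n)) -> K s ->
  K (rho ^+ N * s + \sum_(n < N) rho ^+ n * t n).
Proof.
move=> KT; elim: N t => [|N IH] t Tt Ks; first by rewrite big_ord0 expr0 mul1r addr0.
rewrite big_ord_recl expr0 mul1r.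
have := KT _ _ (IH (fun n => t n.+1) (fun n => Tt n.+1) Ks) (Tt 0%N).
congr K; rewrite exprS mulrDr mulrA -addrA; congr (_ + _); rewrite addrC.
congr (_ + _); rewrite mulr_sumr; apply: eq_bigr => i _.
by rewrite /= /bump/= add1n exprS mulrA.
Qed.

(** The sums of initial segments already form a [T]-net, since consecutive ones
    differ by a single [a k]; subsets are therefore encoded by a cut-off [j]. *)
Lemma prefix_sum_approx (R : realType) (a : nat -> R) (M : nat) (T y : R) :
  (forall k, (k < M)%N -> a k <= T) ->
  0 <= y <= T + \sum_(k < M) a k ->
  exists j : nat, 0 <= y - \sum_(k < M | (k < j)%N) a k <= T.
Proof.
elim: M => [|M IH] aT /andP[y0 yT].
  by exists 0%N; move: yT; rewrite !big_ord0 addr0 subr0 y0.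
have [yM|yM] := leP y (T + \sum_(k < M) a k).
  have [||j jy] := IH; first by move=> k kM; apply: aT; rewrite ltnS ltnW.
    by rewrite y0.
  exists (minn j M); rewrite big_mkcond big_ord_recr/= ltnNge geq_minr addr0.
  rewrite -big_mkcond/= (eq_bigl (fun k : 'I_M => (k < j)%N))// => k.
  by rewrite leq_min ltn_ord andbT.
exists M.+1; rewrite (eq_bigl xpredT); last by move=> k; rewrite ltn_ord.
have := aT M (ltnSn M); move: yT; rewrite !big_ord_recr/= => yT aM.
by apply/andP; split; lra.
Qed.

(** Greedy expansion.  The interval [[0, H]] is covered by the translates of
    [delta * [0, H]] by the prefix sums, whose gaps are at most [delta * H] and
    whose total is [(1 - delta) * H]; so subtracting a suitable prefix sum and
    dividing by [delta] maps [[0, H]] into itself, and this can be iterated. *)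
Lemma prefix_digit_expansion (R : realType) (delta H : R) (a : nat -> R)
    (M : nat) (y : R) :
  0 < delta < 1 -> (1 - delta) * H = \sum_(k < M) a k ->
  (forall k, (k < M)%N -> a k <= delta * H) -> 0 <= y <= H ->
  exists j : nat -> nat,
    (fun N => \sum_(m < N) delta ^+ m * \sum_(k < M | (k < j m)%N) a k) @ \oo --> y.
Proof.
move=> /andP[d0 d1] HA aH yH.
have step z : exists j : nat, 0 <= z <= H ->
    0 <= (z - \sum_(k < M | (k < j)%N) a k) / delta <= H.
  have [zH|_] := boolP (0 <= z <= H); last by exists 0%N.
  have [|j /andP[j0 j1]] := prefix_sum_approx aH (y := z).
    by rewrite -HA; move: zH; rewrite (_ : _ + _ = H); [|ring].
  by exists j => _; rewrite ler_pdivlMr// mul0r ler_pdivrMr// j0 mulrC.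
have [g gP] := choice step.
pose S z := \sum_(k < M | (k < g z)%N) a k.
pose z := fix z n := if n is n'.+1 then (z n' - S (z n')) / delta else y.
have zH n : 0 <= z n <= H.
  by elim: n => [//|n IH] /=; exact: gP.
exists (g \o z).
have E N : \sum_(m < N) delta ^+ m * S (z m) = y - delta ^+ N * z N.
  elim: N => [|N IH]; first by rewrite big_ord0 expr0 mul1r subrr.
  rewrite big_ord_recr/= IH exprS.
  have d0' : delta != 0 by rewrite gt_eqF.
  by field.
rewrite (_ : (fun N => _) = (fun N => y - delta ^+ N * z N)); last exact/funext.
rewrite -[X in _ --> X]subr0; apply: cvgB; first exact: cvg_cst.
apply: (@squeeze_cvgr _ _ _ _ (fun=> 0) (fun N => delta ^+ N * H)).
- near=> N; have /andP[z0 z1] := zH N; apply/andP; split.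
    by rewrite mulr_ge0// exprn_ge0// ltW.
  by rewrite ler_wpM2l// exprn_ge0// ltW.
- exact: cvg_cst.
- rewrite -[X in _ --> X](mul0r H); apply: cvgM; last exact: cvg_cst.
  by apply: cvg_expr; rewrite ger0_norm// ltW.
Unshelve. all: by end_near.
Qed.

(** Powers of [delta] have ratio [delta], so one multiple falls in any window
    with that ratio: take the first [n] for which the upper bound holds. *)
Lemma geometric_rescaling (R : realType) (delta eps t : R) :
  0 < delta < 1 -> 0 < eps <= t ->
  exists n, delta * eps <= delta ^+ n * t <= eps.
Proof.
move=> /andP[d0 d1] /andP[e0 et].
have t0 : 0 < t by exact: lt_le_trans et.
have : exists n, delta ^+ n * t <= eps.
  have /cvgrPdist_le/(_ (eps / t))[|N _ /(_ N (leqnn N))] :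
      (fun n => delta ^+ n) @ \oo --> (0 : R).
  - by apply: cvg_expr; rewrite ger0_norm// ltW.
  - by rewrite divr_gt0.
  - rewrite sub0r normrN ger0_norm ?exprn_ge0 ?(ltW d0)// => h.
    by exists N; rewrite -ler_pdivlMr.
move=> /ex_minnP[[|n] ne nmin].
  exists 0%N; rewrite ne andbT expr0 mul1r; apply: le_trans et.
  by rewrite ler_piMl ?ltW.
exists n.+1; rewrite ne andbT exprS -mulrA ler_wpM2l ?ltW//.
by rewrite ltNge; apply/negP => /nmin; rewrite ltnn.
Qed.

Lemma cvg_sum_delay (R : realType) (delta : R) (b : nat -> bool) (p : nat) (Y : R) :
  (fun N => \sum_(m < N) delta ^+ m * (b m)%:R) @ \oo --> Y ->
  (fun N => \sum_(n < N) delta ^+ n * ((p <= n)%N && b (n - p)%N)%:R) @ \oo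
    --> delta ^+ p * Y.
Proof.
move=> bY; rewrite -(cvg_shiftn p).
rewrite (_ : [sequence _]_n =
    (fun N => delta ^+ p * \sum_(m < N) delta ^+ m * (b m)%:R)).
  by apply: cvgM => //; exact: cvg_cst.
apply/funext => N /=; rewrite addnC big_split_ord/= big1 ?add0r; last first.
  by move=> i _; rewrite leqNgt ltn_ord/= mulr0.
rewrite mulr_sumr; apply: eq_bigr => i _.
by rewrite leq_addr/= addKn exprD mulrA.
Qed.

Lemma is_cvg_binary_expansion (R : realType) (delta : R) (b : nat -> bool) :
  0 <= delta < 1 ->
  exists Y : R, (fun N => \sum_(m < N) delta ^+ m * (b m)%:R) @ \oo --> Y.
Proof.
move=> /andP[d0 d1].
have : cvgn (series (fun m => delta ^+ m * (b m)%:R)).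
  apply: (@series_le_cvg _ _ (geometric 1 delta)) => [n|n|n|] /=.
  - by rewrite mulr_ge0// exprn_ge0.
  - by rewrite mul1r exprn_ge0.
  - by rewrite mul1r ler_piMr ?exprn_ge0//; case: (b n).
  - by apply: is_cvg_geometric_series; rewrite ger0_norm.
move=> /cvg_ex[Y bY]; exists Y; apply: cvg_trans bY.
by under eq_fun do rewrite -(big_mkord xpredT (fun m => delta ^+ m * (b m)%:R)).
Qed.

(** * Intervals in homogeneous attractors *)

Lemma interval_of_affine_image (R : realType) (K : set R) (H u v : R) :
  0 < H -> v != 0 -> (forall y, 0 <= y <= H -> K (u + v * y)) ->
  exists a b : R, a < b /\ `[a, b] `<=` K.
Proof.
move=> H0 v0 KP.
have KE x : 0 <= (x - u) / v <= H -> K x.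
  by move=> /KP; rewrite mulrC divfK// addrC subrK.
case/orP: (lt_total v0) => v0'.
- exists (u + v * H), u; split; first by rewrite gtrDl nmulr_rlt0.
  move=> x /=; rewrite in_itv/= => /andP[x1 x2]; apply: KE.
  by rewrite ler_ndivlMr// ler_ndivrMr// mul0r; apply/andP; split; lra.
- exists u, (u + v * H); split; first by rewrite ltrDl mulr_gt0.
  move=> x /=; rewrite in_itv/= => /andP[x1 x2]; apply: KE.
  by rewrite ler_pdivlMr// ler_pdivrMr// mul0r; apply/andP; split; lra.
Qed.

(** The topological content of the theorem: the maps [c |-> r c + b0] and
    [c |-> r c + b1] with a common ratio give [C] enough binary digits for the
    sums of the [delta^n C] to fill an interval, however small [delta] and [r]
    are. *)
Lemma homogeneous_set_has_interval (R : realType) (K C : set R)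
    (delta r b0 b1 : R) :
  0 < delta < 1 -> 0 < r < 1 -> b0 != b1 ->
  closed K -> K !=set0 -> C !=set0 ->
  (forall x c, K x -> C c -> K (homogeneous_map delta c x)) ->
  (forall c, C c -> C (r * c + b0) /\ C (r * c + b1)) ->
  exists a b : R, a < b /\ `[a, b] `<=` K.
Proof.
move=> /andP[d0 d1] /andP[r0 r1] b01 clK [s0 Ks0] [c0 Cc0] KC CC.
have d1' : 1 - delta != 0 by rewrite subr_eq0 gt_eqF.
(* M delta ^ 2 >= 1 is what makes the prefix sums dense enough in He below *)
pose M := Num.bound (delta ^- 2).
have M2 : 1 <= M%:R * delta ^+ 2.
  rewrite -ler_pdivrMr ?exprn_gt0// div1r ltW// archi_boundP//.
  by rewrite invr_ge0 exprn_ge0// ltW.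
pose eps := r ^+ M; have e0 : 0 < eps by rewrite exprn_gt0.
have delay k : exists n, (k < M)%N ->
    delta * eps <= delta ^+ n * r ^+ k <= eps.
  have [kM|_] := ltnP k M; last by exists 0%N.
  have [||n nP] := @geometric_rescaling _ delta eps (r ^+ k); rewrite ?d0 ?e0//=.
    by rewrite ler_wiXn2l ?(ltW r0) ?(ltW r1) ?(ltnW kM).
  by exists n.
have [p pP] := choice delay.
pose a k := delta ^+ p k * r ^+ k.
pose H := (\sum_(k < M) a k) / (1 - delta).
have HE : (1 - delta) * H = \sum_(k < M) a k by rewrite /H mulrC divfK.
have A_ge : M%:R * (delta * eps) <= \sum_(k < M) a k.
  rewrite -[X in X%:R * _](card_ord M) mulr_natl -sumr_const.
  by apply: ler_sum => k _; have /andP[] := pP k (ltn_ord k).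
(* all a k are at most eps, hence the greedy expansion applies on [0, H] *)
have He : eps <= delta * H.
  rewrite /H mulrA ler_pdivlMr ?subr_gt0//.
  apply: (@le_trans _ _ (delta * (M%:R * (delta * eps)))); last first.
    by rewrite ler_wpM2l// ltW.
  rewrite (_ : delta * _ = (M%:R * delta ^+ 2) * eps); last by ring.
  apply: (@le_trans _ _ (1 * eps)); last by rewrite ler_wpM2r// ltW.
  by rewrite mul1r ler_piMr ?(ltW e0)// gerBl ltW.
have H0 : 0 < H by rewrite -(pmulr_rgt0 _ d0); exact: lt_le_trans He.
pose u := r ^+ M * c0 + b0 * \sum_(k < M) r ^+ k.
apply: (@interval_of_affine_image _ K H u ((1 - delta) * (b1 - b0))) => //.
  by rewrite mulf_neq0// subr_eq0 eq_sym.
move=> y yH.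
have aH k : (k < M)%N -> a k <= delta * H.
  by move=> /pP/andP[_ ae]; exact: le_trans He.
have [|j jy] := prefix_digit_expansion _ HE aH yH; first by rewrite d0.
have [Y YP] := choice (fun k => is_cvg_binary_expansion (fun m => (k < j m)%N)
  (introT andP (conj (ltW d0) d1))).
(* exchanging the two sums separates y into M binary expansions in base delta *)
have yE : y = \sum_(k < M) a k * Y k.
  apply: (cvg_unique _ jy) => //.
  rewrite (_ : (fun N => _) = (fun N =>
      \sum_(k < M) a k * \sum_(m < N) delta ^+ m * (k < j m)%N%:R)).
    apply: cvg_big => [|k _]; first exact: add_continuous.
    by apply: cvgM; [exact: cvg_cst|exact: YP].
  apply/funext => N; under eq_bigr do rewrite big_mkcond mulr_sumr.
  rewrite exchange_big; apply: eq_bigr => k _; rewrite mulr_sumr.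
  apply: eq_bigr => m _; case: ifP => _; last by rewrite !mulr0.
  by rewrite mulr1 mulrC.
(* the k-th expansion starts at position p k, which supplies the missing factor
   delta ^+ p k of a k *)
pose e n k := (p k <= n)%N && (k < j (n - p k)%N)%N.
pose c n := u + (b1 - b0) * \sum_(k < M) r ^+ k * (e n k)%:R.
have Cc n : C (c n).
  have := @affine_orbit_mem _ C [set b0; b1] r c0
    (fun k => if e n k then b1 else b0) M.
  rewrite (_ : _ + _ = c n); first apply => //.
  - by move=> x t Cx [] ->; have [] := CC _ Cx.
  - by move=> k; case: ifP => _; [right|left].
  rewrite /c /u -addrA; congr (_ + _); rewrite !mulr_sumr -big_split/=.
  by apply: eq_bigr => k _; case: (e n k) => /=; ring.
pose P N := delta ^+ N * s0 + \sum_(n < N) delta ^+ n * ((1 - delta) * c n).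
have KP N : K (P N).
  apply: (@affine_orbit_mem _ K [set (1 - delta) * x | x in C] delta s0
    (fun n => (1 - delta) * c n)) => //.
    by move=> x _ Kx [c' Cc' <-]; exact: KC.
  by move=> n; exists (c n).
apply: (@closed_cvg _ _ \oo _ P K clK).
  by apply: nearW => N; exact: KP.
have PE N : P N = delta ^+ N * (s0 - u) + u + (1 - delta) * (b1 - b0) *
    \sum_(k < M) r ^+ k * \sum_(n < N) delta ^+ n * (e n k)%:R.
  pose q n := \sum_(k < M) r ^+ k * (e n k)%:R.
  have -> : \sum_(k < M) r ^+ k * (\sum_(n < N) delta ^+ n * (e n k)%:R) =
      \sum_(n < N) delta ^+ n * q n.
    under eq_bigr do rewrite mulr_sumr.
    rewrite exchange_big; apply: eq_bigr => n _; rewrite mulr_sumr.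
    by apply: eq_bigr => k _; rewrite mulrCA.
  have -> : P N = delta ^+ N * s0 + (u * ((1 - delta) * \sum_(n < N) delta ^+ n)
      + (1 - delta) * (b1 - b0) * \sum_(n < N) delta ^+ n * q n).
    congr (_ + _); rewrite !mulr_sumr -big_split/=.
    by apply: eq_bigr => n _; rewrite /c -/(q n); ring.
  by rewrite -[1 - delta]opprB mulNr -subrX1; ring.
rewrite (funext PE : P = _).
rewrite yE -[X in _ --> X + _](add0r u); apply: cvgD; first apply: cvgD.
- rewrite -[X in _ --> X](mul0r (s0 - u)); apply: cvgM; last exact: cvg_cst.
  by apply: cvg_expr; rewrite ger0_norm// ltW.
- exact: cvg_cst.
apply: cvgM; first exact: cvg_cst.
apply: cvg_big => [|k _]; first exact: add_continuous.
rewrite /a mulrAC mulrC; apply: cvgM; first exact: cvg_cst.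
exact: (@cvg_sum_delay _ delta (fun m => (k < j m)%N) (p k) _ (YP k)).
Qed.

Theorem theorem1 (R : realType) (beta_ delta_ w : 'I_2 -> R)
    (hbeta : forall i, 0 <= beta_ i <= 1)
    (hbeta_neq : beta_ ord0 <> beta_ ord_max)
    (hdelta_ : forall i, 0 < delta_ i < 1 / 3)
    (hw : forall i, 0 < w i)
    (hw1 : \sum_(i < 2) w i = 1)
    (sigma : borel_probability R)
    (hsigma : is_invariant_measure
                (fun i => affine_map (delta_ i) (beta_ i)) w sigma)
    (hdisc : disconnected_IFS (fun i => affine_map (delta_ i) (beta_ i)))
    (delta : R) (hdelta : 0 < delta < 1)
    (mu : borel_probability R)
    (hmu : is_homogeneous_invariant_measure delta sigma mu) :
  exists a b : R, a < b /\ `[a, b] `<=` measure_support mu.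
Proof.
have dlt i : 0 < delta_ i < 1.
  by have /andP[h1 h2] := hdelta_ i; apply/andP; split; lra.
have dle i : 0 <= delta_ i <= 1 by have /andP[h1 h2] := dlt i; rewrite !ltW.
have phiC i := @support_invariant _ _ _ _ _ _ i _ hw (dle i) hsigma.
pose phi i := affine_map (delta_ i) (beta_ i).
have /andP[p0 q0] := dlt ord0; have /andP[p1 q1] := dlt ord_max.
apply: (@homogeneous_set_has_interval _ (measure_support mu)
  (measure_support sigma) delta (delta_ ord0 * delta_ ord_max)
  (phi ord0 (phi ord_max 0)) (phi ord_max (phi ord0 0))) => //.
- by rewrite mulr_gt0//= mulr_ilt1// ltW.
- (* the translation parts differ by
     (1 - delta_ ord0) * (1 - delta_ ord_max) * (beta_ ord0 - beta_ ord_max) *)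
  rewrite -subr_eq0 (_ : _ - _ = (1 - delta_ ord0) * (1 - delta_ ord_max) *
    (beta_ ord0 - beta_ ord_max)); last by rewrite /phi /affine_map; ring.
  rewrite !mulf_neq0 ?subr_eq0 ?(gt_eqF q0) ?(gt_eqF q1)//; exact/eqP.
- exact: closed_measure_support.
- exact: measure_support_neq0.
- exact: measure_support_neq0.
- move=> x c Kx Cc; apply: support_homogeneous hmu Cc Kx.
  by have /andP[h1 h2] := hdelta; rewrite !ltW.
move=> c Cc; split.
- rewrite (_ : _ + _ = phi ord0 (phi ord_max c)); first exact/phiC/phiC.
  by rewrite /phi /affine_map; ring.
- rewrite (_ : _ + _ = phi ord_max (phi ord0 c)); first exact/phiC/phiC.
  by rewrite /phi /affine_map; ring.
Qed.
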